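(* There is a universal constant $c>0$ such that the following holds. Let $\Omega\subset\mathbb R^d$ be compact, $\mu$ a probability measure on $\Omega$, $X_N$ an $N$-dimensional subspace of $\mathcal C(\Omega)$, $q\in[2,\infty)$, and $H>0$ such that $\|f\|_\infty\le H\|f\|_q$ for all $f\in X_N$. Let $X_N^q:=\{f\in X_N:\|f\|_q\le1\}$, let $\mathbf x_1,\dots,\mathbf x_m\in\Omega$ be arbitrary fixed points, and let $\chi_1,\dots,\chi_m$ be independent symmetric Bernoulli random variables taking values $\pm1$. Then $$ \mathbb E\Big[\sup_{f\in X_N^q}\Big|\sum_{j=1}^m\chi_j|f(\mathbf x_j)|^q\Big|\Big]\le cqH^{q/2}N^{1/2}\sup_{h\in X_N^q}\Big(\sum_{j=1}^m|h(\mathbf x_j)|^q\Big)^{1/2}. $$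
   Context: $\|f\|_q=(\int_\Omega|f|^qd\mu)^{1/q}$ and $\|f\|_\infty=\max_{\mathbf x\in\Omega}|f(\mathbf x)|$. *)

(* Defs.v *)
From HB Require Import structures.
From mathcomp Require Import all_boot all_order all_algebra.
From mathcomp Require Import all_classical all_reals all_analysis.
Set Implicit Arguments. Unset Strict Implicit. Unset Printing Implicit Defensive.
Import Order.TTheory GRing.Theory Num.Theory.
Import numFieldNormedType.Exports.
Local Open Scope classical_set_scope.
Local Open Scope ring_scope.

Definition BorelRd (R : realType) (d : nat) : measurableType _ :=
  g_sigma_algebraType (@open 'rV[R]_d).

Definition lincomb (R : realType) (d N : nat) (phi : 'I_N -> 'rV[R]_d -> R)
  (a : 'I_N -> R) : 'rV[R]_d -> R := fun x => \sum_(i < N) a i * phi i x.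

Definition span_fun (R : realType) (d N : nat) (phi : 'I_N -> 'rV[R]_d -> R)
  : set ('rV[R]_d -> R) := [set f | exists a, f = lincomb phi a].

Definition lin_indep_on (R : realType) (d N : nat) (Omega : set 'rV[R]_d)
  (phi : 'I_N -> 'rV[R]_d -> R) : Prop :=
  forall a : 'I_N -> R, (forall x, Omega x -> lincomb phi a x = 0) ->
    forall i, a i = 0.

Definition Lq_norm (R : realType) (d : nat) (mu : probability (BorelRd R d) R)
  (Omega : set 'rV[R]_d) (q : R) (f : 'rV[R]_d -> R) : R :=
  powR (fine (\int[mu]_(x in (Omega : set (BorelRd R d))) (powR `|f x| q)%:E)) q^-1.

Definition unit_ball_q (R : realType) (d N : nat) (mu : probability (BorelRd R d) R)
  (Omega : set 'rV[R]_d) (q : R) (phi : 'I_N -> 'rV[R]_d -> R)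
  : set ('rV[R]_d -> R) :=
  [set f | span_fun phi f /\ Lq_norm mu Omega q f <= 1].

Definition sgnb (R : realType) (b : bool) : R := if b then 1 else -1.

(* Expectation over m independent symmetric Bernoulli (+-1) variables:
   average over all 2^m sign patterns. *)
Definition bernoulli_expect (R : realType) (m : nat)
  (F : ('I_m -> R) -> R) : R :=
  (2 ^+ m)^-1 * \sum_(s : {ffun 'I_m -> bool}) F (fun j => sgnb R (s j)).

(* Main.v *)
(* Dudley's chaining in the norm max_j |f(x_j)|.  If f, g are in X_N^q and
   |f - g| <= H 2^-k at all the points x_j, then the mean value inequality
   | |f|^q - |g|^q | <= q max(|f|, |g|)^(q-1) |f - g| shows that the increment of
   the Rademacher sum is subgaussian with parameter O(q H^(q/2) S 2^-k), where S is
   the supremum on the right-hand side.  By the Nikolskii inequality X_N^q lies in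
   the ball of radius H of this N-dimensional seminorm, hence it has an
   H 2^-k-net of at most (8 2^k)^N elements, and the entropy sum
   sum_k 2^-k sqrt (N (k + 5)) is O(sqrt N).

   The sharp packing bound (8 / t)^N is obtained without volumes: a crude bound
   (M / t)^N, with M depending on the space, follows from the pigeonhole principle
   in coordinates, and applying it to the sets of sums
   y_1 + tau y_2 + ... + tau^(n-1) y_n, tau = t / 8, removes M as n grows. *)
Require Import Defs.
From HB Require Import structures.
From mathcomp Require Import all_boot all_order all_algebra.
From mathcomp Require Import all_classical all_reals all_analysis.
From mathcomp Require Import ring lra.
Import Order.TTheory GRing.Theory Num.Theory.
Import numFieldNormedType.Exports.
Local Open Scope classical_set_scope.
Local Open Scope ring_scope.

(** * Averages over sign patterns and maxima of subgaussian sums *)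

(** Convertible to [bernoulli_expect], with the integrand taken as a function of the Boolean
    pattern. *)
Definition avg (R : realType) (m : nat) (Y : {ffun 'I_m -> bool} -> R) : R :=
  (2 ^+ m)^-1 * \sum_s Y s.

Lemma ler_avg (R : realType) (m : nat) (Y Z : {ffun 'I_m -> bool} -> R) :
  (forall s, Y s <= Z s) -> avg R m Y <= avg R m Z.
Proof.
move=> YZ; rewrite /avg ler_wpM2l ?invr_ge0 ?exprn_ge0 //.
exact: ler_sum.
Qed.

Lemma avgD (R : realType) (m : nat) (Y Z : {ffun 'I_m -> bool} -> R) :
  avg R m (fun s => Y s + Z s) = avg R m Y + avg R m Z.
Proof. by rewrite /avg big_split mulrDr. Qed.

Lemma avgZ (R : realType) (m : nat) (k : R) (Y : {ffun 'I_m -> bool} -> R) :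
  avg R m (fun s => k * Y s) = k * avg R m Y.
Proof. by rewrite /avg -mulr_sumr mulrCA. Qed.

Lemma avg_cst (R : realType) (m : nat) (k : R) : avg R m (fun=> k) = k.
Proof.
rewrite /avg sumr_const card_ffun card_bool card_ord -[k *+ _]mulr_natl natrX.
by rewrite mulKf // expf_neq0 // pnatr_eq0.
Qed.

Lemma avg_sum (R : realType) (m : nat) (I : finType)
    (Y : I -> {ffun 'I_m -> bool} -> R) :
  avg R m (fun s => \sum_i Y i s) = \sum_i avg R m (Y i).
Proof. by rewrite /avg exchange_big mulr_sumr. Qed.

(* Compare with the geometric series: expR x <= (1 - x)^-1 gives
   cosh x <= (1 - x^2)^-1 when |x| is small. *)
Lemma cosh_le (R : realType) (x : R) :
  expR x + expR (- x) <= 2 * expR (2 * x ^+ 2).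
Proof.
wlog x0 : x / 0 <= x.
  move=> th; have [/th//|/ltW x0] := leP 0 x.
  by rewrite addrC -(sqrrN x) -{2}(opprK x); apply: th; rewrite oppr_ge0.
have [xh|xh] := leP x 2^-1; last first.
  have xx : x <= 2 * x ^+ 2.
    have : 0 <= x * (2 * x - 1) by apply: mulr_ge0 => //; lra.
    by rewrite expr2; lra.
  have h1 : expR x <= expR (2 * x ^+ 2) by rewrite ler_expR.
  have h2 : expR (- x) <= expR (2 * x ^+ 2) by rewrite ler_expR; lra.
  lra.
have inv_bound (y : R) : y < 1 -> expR y <= (1 - y)^-1.
  move=> y1; rewrite -[y in expR y]opprK expRN lef_pV2 ?posrE ?expR_gt0 ?subr_gt0 //.
  exact: expR_ge1Dx.
have h1 : expR x <= (1 - x)^-1 by apply: inv_bound; lra.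
have h2 : expR (- x) <= (1 + x)^-1.
  by have /le_trans -> // := inv_bound (- x) ltac:(lra); rewrite opprK.
have e : (1 - x)^-1 + (1 + x)^-1 = 2 * (1 - x ^+ 2)^-1.
  field; rewrite ?andbT; apply/and3P; split; apply/negP => /eqP; nra.
have t0 : 0 <= x ^+ 2 := sqr_ge0 x.
have t4 : x ^+ 2 <= 4^-1.
  by have := ler_pM x0 x0 xh xh; rewrite -expr2 -invfM -natrM.
have h3 : (1 - x ^+ 2)^-1 <= 1 + 2 * x ^+ 2.
  rewrite -[X in X <= _]mul1r ler_pdivrMr; last by lra.
  have : 0 <= x ^+ 2 * (1 - 2 * x ^+ 2) by apply: mulr_ge0 => //; lra.
  by set t := x ^+ 2; lra.
have := expR_ge1Dx (2 * x ^+ 2); lra.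
Qed.

(** Independence of the signs appears as distributivity: the sum over all patterns of a product is
    the product over j of two-term sums, each bounded by [cosh_le]. *)
Lemma avg_expR (R : realType) (m : nat) (d : 'I_m -> R) :
  avg R m (fun s => expR (\sum_j sgnb R (s j) * d j))
  <= expR (2 * \sum_j d j ^+ 2).
Proof.
rewrite /avg.
under eq_bigr do rewrite expR_sum.
rewrite -(bigA_distr_bigA (fun j b => expR (sgnb R b * d j))) /=.
rewrite ler_pdivrMl ?exprn_gt0 // mulr_sumr expR_sum.
rewrite -[m in 2 ^+ m]card_ord -prodr_const -big_split /=.
by apply: ler_prod => j _; rewrite sumr_ge0 ?big_bool /= ?mul1r ?mulN1r ?cosh_le //.
Qed.

(* Instead of a maximum over I we bound any Y that is dominated, at each sign
   pattern, by one member of the family.  For D > 0 this is the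
   exponential-moment bound with parameter sqrt L / D. *)
Lemma avg_finite_max (R : realType) (m : nat) (I : finType) (d : I -> 'I_m -> R)
    (D L : R) (Y : {ffun 'I_m -> bool} -> R) :
  0 <= D -> 0 < L -> 2 * #|I|%:R <= expR L ->
  (forall i, \sum_j d i j ^+ 2 <= D ^+ 2) ->
  (forall s, exists i, Y s <= `|\sum_j sgnb R (s j) * d i j|) ->
  avg R m Y <= 3 * D * Num.sqrt L.
Proof.
move=> D0 L0 cardI dD Yd.
have [D00|D00] := eqVneq D 0.
  rewrite D00 mulr0 mul0r -(avg_cst R m 0); apply: ler_avg => s.
  have [i /le_trans->//] := Yd s.
  have d0 : forall j, d i j = 0.
    move=> j; apply/eqP; rewrite -sqrf_eq0 eq_le sqr_ge0 andbT.
    have := dD i; rewrite D00 expr0n /= => /(le_trans _); apply.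
    by rewrite (bigD1 j) //= lerDl sumr_ge0 // => k _; rewrite sqr_ge0.
  by rewrite big1 ?normr0 // => j _; rewrite d0 mulr0.
have Dp : 0 < D by rewrite lt_neqAle eq_sym D00.
set r := Num.sqrt L; have rp : 0 < r by rewrite sqrtr_gt0.
have r2 : r ^+ 2 = L by rewrite sqr_sqrtr // ltW.
set l := r / D; have lp : 0 < l by rewrite divr_gt0.
have lD : l * D = r by rewrite /l divfK.
clearbody l.
(* One L pays for the factor [2 * #|I|] and 2 L for each exponential moment; dividing by l = sqrt L
   / D then leaves 3 D sqrt L. *)
set y0 := 3 * L.
have mgf i (k : R) : k ^+ 2 = l ^+ 2 ->
    avg R m (fun s => expR (k * \sum_j sgnb R (s j) * d i j)) <= expR (2 * L).
  move=> kl.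
  have -> : (fun s : {ffun 'I_m -> bool} => expR (k * \sum_j sgnb R (s j) * d i j))
     = (fun s => expR (\sum_j sgnb R (s j) * (k * d i j))).
    apply/funext => s; rewrite mulr_sumr; congr expR.
    by apply: eq_bigr => j _; rewrite mulrCA.
  apply: le_trans (avg_expR _ _ _) _; rewrite ler_expR.
  under eq_bigr do rewrite exprMn kl.
  rewrite -mulr_sumr -r2 -[in leRHS]lD (exprMn _ l).
  by apply: ler_wpM2l => //; apply: ler_wpM2l; rewrite ?sqr_ge0.
have main : avg R m (fun s => expR (l * Y s)) <= expR y0.
  have -> : y0 = L + 2 * L by rewrite /y0; ring.
  apply: (@le_trans _ _ (\sum_(i : I) (expR (2 * L) + expR (2 * L)))).
    apply: (@le_trans _ _ (avg R m (fun s => \sum_i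
       (expR (l * \sum_j sgnb R (s j) * d i j) +
        expR (- l * \sum_j sgnb R (s j) * d i j))))); last first.
      rewrite avg_sum; apply: ler_sum => i _; rewrite avgD.
      by rewrite lerD // mgf // sqrrN.
    apply: ler_avg => s; have [i Yi] := Yd s.
    rewrite (bigD1 i) //=; set Z := \sum_j _ in Yi *.
    apply: ler_wpDr; first by apply: sumr_ge0 => k _; rewrite addr_ge0 ?expR_ge0.
    have : l * Y s <= l * `|Z| by rewrite ler_pM2l.
    rewrite -ler_expR => /le_trans; apply.
    case: (ger0P Z) => _; rewrite ?mulrN ?mulNr ?lerDl ?lerDr expR_ge0 //.
  rewrite sumr_const expRD -mulr2n -mulrnA -[X in X <= _]mulr_natl natrM.
  by rewrite ler_wpM2r ?expR_ge0.
(* Jensen's inequality in tangent form: the tangent to the exponential at [y0], once averaged, turns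
   [main] into a bound on the mean of Y. *)
have jensen s : expR y0 * (1 + (l * Y s - y0)) <= expR (l * Y s).
  rewrite -[l * Y s in leRHS](subrKC y0) expRD ler_wpM2l ?expR_ge0 //.
  exact: expR_ge1Dx.
have : avg R m (fun s => expR y0 * (1 + (l * Y s - y0))) <= expR y0.
  by apply: le_trans main; apply: ler_avg.
rewrite avgZ avgD avg_cst (avgD _ _ (fun s => l * Y s) (fun=> - y0)) avg_cst avgZ.
rewrite ger_pMr ?expR_gt0 // => lY.
have {}lY : l * avg R m Y <= y0 by lra.
rewrite -(ler_pM2l lp); apply: le_trans lY _.
by rewrite /y0 -r2 -lD le_eqVlt; apply/orP; left; apply/eqP; ring.
Qed.

(** * Mean value inequality for powers *)

(** Young's inequality for u = b / a and 1, with exponents q and q / (q - 1), gives q u <= u^q + q -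
    1; it remains to multiply by a^q. *)
Lemma powR_sub_le (R : realType) (q a b : R) : 1 < q -> 0 <= b -> b <= a ->
  a `^ q - b `^ q <= q * a `^ (q - 1) * (a - b).
Proof.
move=> q1 b0 ba; have q0 : 0 < q by lra.
have [a0|a0] := eqVneq a 0.
  have -> : b = 0 by apply/eqP; rewrite eq_le b0 -a0 ba.
  by rewrite a0 !subrr mulr0.
have ap : 0 < a by rewrite lt_neqAle eq_sym a0 (le_trans b0 ba).
have u0 : 0 <= b / a by rewrite divr_ge0 // ltW.
have qm : 0 < q - 1 by lra.
have qn : q != 0 by rewrite gt_eqF.
have qmn : q - 1 != 0 by rewrite gt_eqF.
have := @conjugate_powR R (b / a) 1 q (q / (q - 1)) u0 ler01 q0 (divr_gt0 q0 qm).
have -> : q^-1 + (q / (q - 1))^-1 = 1.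
  by field; rewrite ?qn ?qmn.
rewrite mulr1 powR1 => /(_ erefl) young.
have {young} young : q * (b / a) <= (b / a) `^ q + (q - 1).
  have := ler_wpM2l (ltW q0) young.
  suff -> : q * ((b / a) `^ q / q + 1 / (q / (q - 1))) = (b / a) `^ q + (q - 1) by [].
  by field; rewrite ?qn ?qmn.
have bq : b `^ q = (b / a) `^ q * a `^ q.
  by rewrite -powRM ?divfK // ltW.
have aq : a `^ q = a * a `^ (q - 1) by rewrite mulr_powRB1 // ltW.
have := ler_wpM2l (powR_ge0 a q) young.
rewrite bq => h.
have e : a `^ q * (q * (b / a)) = q * b * a `^ (q - 1).
  by rewrite aq; field.
rewrite e in h.
have : q * a `^ (q - 1) * (a - b) = q * a `^ q - q * b * a `^ (q-1).
  by rewrite aq; ring.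
move=> ->; set X := a `^ q in h *; set Z := (b / a) `^ q in h *; nra.
Qed.

(** * Packings and nets of a row space in the max norm *)

(** A maximal independent family of columns of G determines the other columns linearly; M bounds the
    coefficients of these combinations. *)
Lemma rowspace_coordinates (R : realType) (N m : nat) (G : 'M[R]_(N, m)) :
  exists M : R, 1 <= M /\ exists f : 'I_(\rank G) -> 'I_m,
    forall (v : 'rV_m) (e : R), 0 <= e -> (v <= G)%MS ->
      (forall k, `|v 0 (f k)| <= e) -> forall j, `|v 0 j| <= M * e.
Proof.
rewrite -mxrank_tr; set g := maxrankfun G^T.
have /submxP[W GW] : (G^T <= rowsub g G^T)%MS by rewrite eq_maxrowsub.
exists (1 + \sum_j \sum_k `|W j k|); split.
  by rewrite lerDl sumr_ge0 // => j _; rewrite sumr_ge0.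
exists g => v e e0 /submxP[D vD] ve j.
have -> : v 0 j = \sum_k W j k * v 0 (g k).
  have vT : v^T = W *m rowsub g v^T.
    by rewrite vD trmx_mul -mul_rowsub_mx mulmxA -GW.
  have -> : v 0 j = v^T j 0 by rewrite mxE.
  by rewrite vT mxE; apply: eq_bigr => k _; rewrite !mxE.
apply: le_trans (ler_norm_sum _ _ _) _.
apply: (@le_trans _ _ (\sum_k `|W j k| * e)).
  by apply: ler_sum => k _; rewrite normrM ler_wpM2l.
rewrite -mulr_suml ler_wpM2r // (bigD1 j) //= addrCA lerDl.
by rewrite addr_ge0 // sumr_ge0 // => i _; rewrite sumr_ge0.
Qed.

Definition separated (R : realType) (m : nat) (I : finType) (y : I -> 'rV[R]_m)
    (t : R) :=
  forall i i', i != i' -> exists j, t <= `|y i 0 j - y i' 0 j|.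

(** The coordinates of [rowspace_coordinates] are cut into cells of side t / (2 M). Two points in
    one cell differ by at most t / 2 everywhere, so a separated family has at most one point per
    cell. The radius 2 leaves room for the sums built in [packing_amplify]. *)
Lemma packing_crude (R : realType) (N m : nat) (G : 'M[R]_(N, m)) :
  exists M : R, 1 <= M /\
    forall (I : finType) (y : I -> 'rV[R]_m) (t : R), 0 < t -> t <= 1 ->
      (forall i, (y i <= G)%MS) -> (forall i j, `|y i 0 j| <= 2) ->
      separated R m I y t -> #|I|%:R <= (M / t) ^+ N.
Proof.
have [M [M1 [f Mf]]] := rowspace_coordinates R N m G.
(* Each coordinate has at most 4 / e + 1 = 8 M / t + 1 cells, and t <= 1. The resulting base is at
   least 1, so the exponent can rise from the rank to N. *)
exists (8 * M + 1); split; first by lra.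
move=> I y t t0 t1 yG y2 sep; have M0 : 0 < M by lra.
set r := \rank G in f Mf *.
pose e := t / (2 * M); have e0 : 0 < e by rewrite divr_gt0 // mulr_gt0.
have Me : M * e = t / 2 by rewrite /e; field; rewrite gt_eqF.
have e4 : 4 / e = 8 * M / t by rewrite /e; field; rewrite !gt_eqF.
clearbody e.
pose L := (Num.truncn (4 / e)).+1.
pose cell i := [ffun k : 'I_r => (inord (Num.truncn ((y i 0 (f k) + 2) / e)) : 'I_L)].
have cell_bd i k : 0 <= (y i 0 (f k) + 2) / e <= 4 / e.
  have /ler_normlP[h1 h2] := y2 i (f k).
  rewrite ler_pM2r ?invr_gt0 //; apply/andP; split; last by lra.
  by apply: divr_ge0; [lra | exact: ltW].
have cell_inj : injective cell.
  move=> i i' /ffunP ii; apply/eqP; apply/negPn/negP => /sep[j].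
  apply/negP; rewrite -ltNge.
  have close k : `|(y i - y i') 0 (f k)| <= e.
    have := congr1 (@nat_of_ord _) (ii k).
    have /andP[a0 a1] := cell_bd i k; have /andP[b0 b1] := cell_bd i' k.
    rewrite !ffunE !inordK ?ltnS ?le_truncn // => tt.
    have /andP[u1 u2] := truncn_itv a0; have /andP[w1 w2] := truncn_itv b0.
    rewrite -tt in w1 w2; move: u1 u2 w1 w2; set n := Num.truncn _.
    rewrite -(natr1 n) !ler_pdivlMr // !ltr_pdivrMr // => u1 u2 w1 w2.
    rewrite !mxE; apply/ler_normlP; split; lra.
  have yy : (y i - y i' <= G)%MS.
    by rewrite addmx_sub // -scaleN1r scalemx_sub.
  have := Mf _ _ (ltW e0) yy close j; rewrite !mxE => /le_lt_trans; apply.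
  by rewrite Me; lra.
have := leq_card _ cell_inj; rewrite card_ffun !card_ord => cI.
apply: (@le_trans _ _ (L%:R ^+ r)); first by rewrite -natrX ler_nat.
have Mt : 1 <= (8 * M + 1) / t by rewrite ler_pdivlMr //; lra.
apply: (@le_trans _ _ (((8 * M + 1) / t) ^+ r)); last first.
  by rewrite ler_weXn2l // rank_leq_row.
rewrite lerXn2r ?nnegrE //; first exact: le_trans ler01 Mt.
rewrite /L -(natr1 (Num.truncn _)); apply: (@le_trans _ _ (4 / e + 1)).
  by rewrite lerD2r truncn_le // divr_ge0 // ltW.
rewrite e4 [in leRHS]mulrDl.
by rewrite lerD2l mul1r invf_ge1.
Qed.

(** Induction with y + (t / 8) z. If the leading terms differ, the tails take back at most 4 (t / 8)
    = t / 2 of their distance t; if they agree, the separation of the tails is scaled by t / 8. *)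
Lemma packing_amplify (R : realType) (N m : nat) (G : 'M[R]_(N, m)) (I : finType)
    (y : I -> 'rV[R]_m) (t : R) (n : nat) :
  0 < t -> t <= 1 ->
  (forall i, (y i <= G)%MS) -> (forall i j, `|y i 0 j| <= 1) ->
  separated R m I y t ->
  exists (J : finType) (z : J -> 'rV[R]_m),
    [/\ #|J| = (#|I| ^ n)%N, forall i, (z i <= G)%MS,
        forall i j, `|z i 0 j| <= 2 & separated R m J z ((t / 8) ^+ n)].
Proof.
move=> t0 t1 yG y1 sep; elim: n => [|n [J [z [cJ zG z2 zsep]]]].
  exists unit, (fun=> 0); split.
  - by rewrite card_unit.
  - by move=> _; exact: sub0mx.
  - by move=> _ j; rewrite mxE normr0.
  - by case; case.
have tn1 : (t / 8) ^+ n <= 1 by apply: exprn_ile1; lra.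
exists (I * J)%type, (fun p => y p.1 + (t / 8) *: z p.2); split.
- by rewrite card_prod cJ expnS.
- by move=> p; rewrite addmx_sub // scalemx_sub.
- move=> p j; rewrite !mxE.
  have /ler_normlP[a1 a2] := y1 p.1 j; have /ler_normlP[b1 b2] := z2 p.2 j.
  apply/ler_normlP; split; nra.
- move=> [i a] [i' a'] /=; have [<-|ii] := eqVneq i i'.
    rewrite xpair_eqE eqxx /= => /zsep[j za]; exists j.
    rewrite !mxE opprD addrACA subrr add0r -mulrBr normrM gtr0_norm ?divr_gt0 //.
    by rewrite exprS ler_wpM2l // divr_ge0 // ltW.
  move=> _; have [j yj] := sep _ _ ii; exists j; rewrite !mxE exprS.
  have /ler_normlP[a1 a2] := z2 a j; have /ler_normlP[b1 b2] := z2 a' j.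
  have small : t / 8 * (t / 8) ^+ n <= t / 8 by rewrite ger_pMr ?divr_gt0.
  have w : `|t / 8 * z a' 0 j - t / 8 * z a 0 j| <= t / 2.
    apply/ler_normlP; split; nra.
  apply: le_trans small _; apply: (@le_trans _ _ (t - t / 2)); first by lra.
  apply: le_trans (lerB yj w) _.
  apply: le_trans (lerB_dist _ _) _.
  by rewrite le_eqVlt; apply/orP; left; apply/eqP; congr `|_|; ring.
Qed.

(* If the bound failed, the n-fold amplification would beat the crude bound
   for large n, because its constant does not depend on n. *)
Lemma packing_bound (R : realType) (N m : nat) (G : 'M[R]_(N, m)) (I : finType)
    (y : I -> 'rV[R]_m) (t : R) :
  0 < t -> t <= 1 ->
  (forall i, (y i <= G)%MS) -> (forall i j, `|y i 0 j| <= 1) ->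
  separated R m I y t -> #|I|%:R <= (8 / t) ^+ N.
Proof.
move=> t0 t1 yG y1 sep; rewrite leNgt; apply/negP => big.
have [M [M1 crude]] := packing_crude R N m G.
set b := (8 / t) ^+ N in big.
have b0 : 0 < b by rewrite exprn_gt0 // divr_gt0.
have t8 : 0 < t / 8 by rewrite divr_gt0.
have pow n : (#|I|%:R / b) ^+ n <= M ^+ N.
  have [J [z [cJ zG z2 zsep]]] := packing_amplify R N m G I y t n t0 t1 yG y1 sep.
  have tn0 : 0 < (t / 8) ^+ n by rewrite exprn_gt0.
  have tn1 : (t / 8) ^+ n <= 1 by apply: exprn_ile1; lra.
  have := crude J z _ tn0 tn1 zG z2 zsep.
  rewrite cJ natrX [in leRHS]expr_div_n => h.
  rewrite expr_div_n ler_pdivrMr; last exact: exprn_gt0; apply: le_trans h _.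
  rewrite ler_pM2l ?exprn_gt0 //; last by lra.
  by rewrite /b -!exprM -exprVn invf_div mulnC.
set u := #|I|%:R / b - 1.
have u0 : 0 < u by rewrite subr_gt0 ltr_pdivlMr // mul1r.
pose n := (Num.truncn (M ^+ N / u)).+1.
have := pow n; apply/negP; rewrite -ltNge.
(* Bernoulli's inequality: powers of 1 + u grow at least linearly, which contradicts the uniform
   bound [pow]. *)
have lin k : 1 + k%:R * u <= (#|I|%:R / b) ^+ k.
  have -> : #|I|%:R / b = 1 + u by rewrite /u; ring.
  elim: k => [|k IH]; first by rewrite mul0r addr0 expr0.
  rewrite exprS -natr1.
  have := ler_wpM2l (_ : 0 <= 1 + u) IH.
  move=> /(_ ltac:(lra)); apply: le_trans.
  have : 0 <= k%:R * (u * u) by rewrite mulr_ge0 // mulr_ge0 // ltW.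
  lra.
apply: lt_le_trans (lin n).
have : M ^+ N / u < n%:R by rewrite /n truncnS_gt.
rewrite ltr_pdivrMr //; lra.
Qed.

(** A separated family of maximal cardinality is a net, since a point far from all its members could
    be adjoined. *)
Lemma separated_net (R : realType) (m : nat) (T : set 'rV[R]_m) (e B : R) :
  (forall (I : finType) (y : I -> 'rV[R]_m), (forall i, T (y i)) ->
     separated R m I y e -> #|I|%:R <= B) ->
  exists (I : finType) (y : I -> 'rV[R]_m),
    [/\ forall i, T (y i), #|I|%:R <= B &
        forall v, T v -> exists i, forall j, `|v 0 j - y i 0 j| <= e].
Proof.
move=> bound.
pose P n := `[< exists (I : finType) (y : I -> 'rV[R]_m),
   [/\ #|I| = n, forall i, T (y i) & separated R m I y e] >].
have exP : exists n, P n.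
  exists 0%N; apply/asboolP; exists void, (fun x : void => match x with end).
  by split; [rewrite card_void | case | case].
have ubP n : P n -> (n <= Num.truncn B)%N.
  move=> /asboolP[I [y [<- Ty sep]]].
  have := bound I y Ty sep => h; rewrite truncn_ge_nat //.
  exact: le_trans h.
case: (ex_maxnP exP ubP) => n /asboolP[I [y [cI Ty sep]]] nmax.
exists I, y; split=> // [|v Tv]; first exact: bound sep.
apply: contrapT => far.
suff /nmax : P n.+1 by rewrite ltnn.
have {}far i : exists j, e <= `|v 0 j - y i 0 j|.
  apply: contrapT => near; apply: far; exists i => j.
  rewrite leNgt; apply/negP => lt; apply: near; exists j; exact: ltW.
apply/asboolP; exists (option I), (fun o => if o is Some i then y i else v); split.
- by rewrite card_option cI.
- by case.
- case=> [i|] [i'|] //= ii; first exact: sep.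
    by have [j hj] := far i; exists j; rewrite distrC.
Qed.

(** * Increments of q-th powers and nets at dyadic scales *)

Lemma powR_dist_le (R : realType) (q a b : R) : 1 < q -> 0 <= a -> 0 <= b ->
  `|a `^ q - b `^ q| <= q * Num.max a b `^ (q - 1) * `|a - b|.
Proof.
move=> q1; wlog ba : a b / b <= a.
  move=> th a0 b0; have /orP[/th->//|ab] := le_total b a.
  by rewrite distrC (distrC a) maxC th.
move=> a0 b0; rewrite max_l // (ger0_norm (x := a - b)) ?subr_ge0 //.
rewrite ger0_norm ?powR_sub_le // subr_ge0.
by apply: ge0_ler_powR; rewrite ?nnegrE //; lra.
Qed.

(** With b <= a, the squared mean value bound contains a^(2q - 2) = a^(q - 2) a^q. Only the first
    factor is replaced by a power of H; the second is kept so that summing over the points produces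
    S^2. *)
Lemma powR_dist_sqr_le (R : realType) (q a b H : R) : 2 <= q ->
  0 <= a -> 0 <= b -> a <= H -> b <= H ->
  (a `^ q - b `^ q) ^+ 2 <=
    q ^+ 2 * H `^ (q - 2) * (a `^ q + b `^ q) * (a - b) ^+ 2.
Proof.
move=> q2; wlog ba : a b / b <= a.
  move=> th a0 b0 aH bH; have /orP[/th->//|ab] := le_total b a.
  by rewrite -sqrrN opprB (addrC (a `^ q)) -(sqrrN (a - b)) opprB th.
move=> a0 b0 aH bH; have q1 : 1 < q by lra.
have := powR_dist_le R q a b q1 a0 b0; rewrite max_l // => h.
have q0 : 0 <= q by lra.
rewrite -real_normK ?num_real // -(real_normK (num_real (a - b))).
apply: (@le_trans _ _ ((q * a `^ (q - 1) * `|a - b|) ^+ 2)).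
  by rewrite lerXn2r // nnegrE // !mulr_ge0 ?powR_ge0.
rewrite !exprMn ler_wpM2r ?sqr_ge0 // -mulrA ler_wpM2l ?sqr_ge0 //.
have [a00|an] := eqVneq a 0.
  rewrite a00 powR0 ?subr_eq0 ?gt_eqF // expr0n /=.
  by rewrite mulr_ge0 ?addr_ge0 ?powR_ge0.
have -> : (a `^ (q - 1)) ^+ 2 = a `^ (q - 2) * a `^ q.
  by rewrite expr2 -!powRD ?an ?implybT //; congr powR; ring.
apply: ler_pM; rewrite ?powR_ge0 // ?lerDl ?powR_ge0 //.
by apply: ge0_ler_powR; rewrite ?nnegrE //; lra.
Qed.

(** Division by H reduces to the unit ball with separation 2^-k. The net lies in T itself, so the
    bounds assumed on T hold for its points. *)
Lemma scaled_net (R : realType) (N m : nat) (G : 'M[R]_(N, m))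
    (T : set 'rV[R]_m) (H : R) (k : nat) : 0 < H ->
  (forall v, T v -> (v <= G)%MS) -> (forall v j, T v -> `|v 0 j| <= H) ->
  exists (I : finType) (y : I -> 'rV[R]_m),
    [/\ forall i, T (y i), #|I|%:R <= ((8 * 2 ^+ k) ^+ N : R) &
        forall v, T v -> exists i, forall j, `|v 0 j - y i 0 j| <= H / 2 ^+ k].
Proof.
move=> H0 TG TH; apply: separated_net => I y Ty sep.
have -> : 8 * 2 ^+ k = 8 / (2 ^+ k)^-1 :> R by rewrite invrK.
apply: (packing_bound R N m G I (fun i => H^-1 *: y i)).
- by rewrite invr_gt0 exprn_gt0.
- by rewrite invf_le1 ?exprn_gt0 // exprn_ege1 // ler1n.
- by move=> i; rewrite scalemx_sub // TG.
- move=> i j; rewrite mxE normrM gtr0_norm ?invr_gt0 // mulrC.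
  by rewrite ler_pdivrMr // mul1r TH.
- move=> i i' /sep[j hj]; exists j; rewrite !mxE -mulrBr normrM.
  by rewrite gtr0_norm ?invr_gt0 // mulrC ler_pdivlMr // mulrC.
Qed.

(** * Chaining for Rademacher sums of value vectors *)

Definition rad_sum (R : realType) (m : nat) (q : R) (v : 'rV[R]_m)
    (s : {ffun 'I_m -> bool}) : R :=
  \sum_j sgnb R (s j) * `|v 0 j| `^ q.

(** The pointwise bounds sum to 2 (q H^(q/2) S r)^2; the factor 2 is enlarged to 4 to give a perfect
    square. *)
Lemma increment_sqr_le (R : realType) (m : nat) (q H S r : R) (v w : 'rV[R]_m) :
  2 <= q -> 0 < H -> 0 <= r ->
  (forall j, `|v 0 j| <= H) -> (forall j, `|w 0 j| <= H) ->
  \sum_j `|v 0 j| `^ q <= S ^+ 2 -> \sum_j `|w 0 j| `^ q <= S ^+ 2 ->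
  (forall j, `|v 0 j - w 0 j| <= H * r) ->
  \sum_j (`|v 0 j| `^ q - `|w 0 j| `^ q) ^+ 2
    <= (2 * (q * H `^ (q / 2) * S) * r) ^+ 2.
Proof.
move=> q2 H0 r0 vH wH vS wS vw.
apply: (@le_trans _ _ (\sum_j q ^+ 2 * H `^ q * r ^+ 2 *
    (`|v 0 j| `^ q + `|w 0 j| `^ q))).
  apply: ler_sum => j _.
  apply: le_trans (powR_dist_sqr_le R q _ _ H q2 _ _ (vH j) (wH j)) _ => //.
  have -> : H `^ q = H `^ (q - 2) * H ^+ 2.
    rewrite -powR_mulrn ?ltW // -powRD ?(gt_eqF H0) ?implybT //.
    by rewrite subrK.
  have : (`|v 0 j| - `|w 0 j|) ^+ 2 <= (H * r) ^+ 2.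
    rewrite -(real_normK (num_real (_ - _))) lerXn2r ?nnegrE ?normr_ge0 //.
      by rewrite mulr_ge0 // ltW.
    exact: le_trans (ler_dist_dist _ _) (vw j).
  set X := _ ^+ 2 => hX.
  set P := `|v 0 j| `^ q + _.
  have P0 : 0 <= q ^+ 2 * H `^ (q - 2) * P.
    by rewrite mulr_ge0 ?addr_ge0 ?powR_ge0 // mulr_ge0 ?sqr_ge0 ?powR_ge0.
  apply: le_trans (ler_wpM2l P0 hX) _.
  by rewrite le_eqVlt; apply/orP; left; apply/eqP; ring.
rewrite -mulr_sumr big_split /=.
have Hq : H `^ q = (H `^ (q / 2)) ^+ 2.
  by rewrite -powR_mulrn ?powR_ge0 // -powRrM divfK.
rewrite Hq; set h := H `^ _.
have P0 : 0 <= q ^+ 2 * h ^+ 2 * r ^+ 2 by rewrite -!exprMn sqr_ge0.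
have := ler_wpM2l P0 (lerD vS wS) => /le_trans; apply.
have : 0 <= q ^+ 2 * h ^+ 2 * r ^+ 2 * S ^+ 2 by rewrite mulr_ge0 ?sqr_ge0.
set X := q ^+ 2 * h ^+ 2 * r ^+ 2 * S ^+ 2 => X0.
have -> : q ^+ 2 * h ^+ 2 * r ^+ 2 * (S ^+ 2 + S ^+ 2) = 2 * X by rewrite /X; ring.
have -> : (2 * (q * h * S) * r) ^+ 2 = 4 * X by rewrite /X; ring.
lra.
Qed.

(** Supplies the cardinality hypothesis of [avg_finite_max] with L = (k + 4) N: the factor 2 is
    absorbed in 2^N because N > 0, and 2 <= e. *)
Lemma entropy_le_expR (R : realType) (N k n : nat) : (0 < N)%N ->
  n%:R <= ((8 * 2 ^+ k) ^+ N : R) -> 2 * n%:R <= expR ((k + 4) * N)%:R :> R.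
Proof.
move=> N0 nk; apply: (@le_trans _ _ (2 ^+ N * (8 * 2 ^+ k) ^+ N)).
  by apply: ler_pM => //; rewrite -[leLHS]expr1 ler_eXn2l // ltr1n.
rewrite -exprMn.
have -> : 2 * (8 * 2 ^+ k) = 2 ^+ (k + 4) :> R by rewrite exprD; ring.
rewrite -exprM -[X in expR X]mulr1 expRM_natl lerXn2r ?nnegrE ?expR_ge0 //.
by have := expR_ge1Dx (1 : R).
Qed.

(** Any growth rate below 2 would do against the scale 2^-k; the rate 3/2 makes the entropy sum
    geometric with ratio 3/4. *)
Lemma sqrt_level_le (R : realType) (k : nat) :
  Num.sqrt ((k.+1 + 4)%:R) <= 3 * (3 / 2) ^+ k :> R.
Proof.
have p0 : 0 <= 3 * (3 / 2) ^+ k :> R by rewrite mulr_ge0 // exprn_ge0.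
rewrite -[leRHS](ger0_norm p0) -sqrtr_sqr ler_wsqrtr //.
rewrite exprMn -exprM mulnC exprM.
elim: k {p0} => [|k IH]; first by rewrite expr0 mulr1 -natrX ler_nat.
rewrite addSn -natr1 [X in _ * X]exprS.
have : 1 <= ((3 / 2) ^+ 2) ^+ k :> R by apply: exprn_ege1; lra.
lra.
Qed.

(** The net at level 0 is the zero vector, and each further level adds at most 18 A (3/4)^k, with 18
    = 3 * 2 * 3 from [avg_finite_max], [increment_sqr_le] and [sqrt_level_le]. The last factor is
    the partial geometric sum. *)
Lemma chaining_level (R : realType) (N m : nat) (G : 'M[R]_(N, m))
    (T : set 'rV[R]_m) (q H S : R) (k : nat) :
  2 <= q -> 0 < H -> 0 <= S -> (0 < N)%N -> T 0 ->
  (forall v, T v -> (v <= G)%MS) -> (forall v j, T v -> `|v 0 j| <= H) ->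
  (forall v, T v -> \sum_j `|v 0 j| `^ q <= S ^+ 2) ->
  exists (I : finType) (y : I -> 'rV[R]_m),
    [/\ forall i, T (y i),
        forall v, T v -> exists i, forall j, `|v 0 j - y i 0 j| <= H / 2 ^+ k &
        forall Y, (forall s, exists i, Y s <= `|rad_sum R m q (y i) s|) ->
          avg R m Y <= 18 * (q * H `^ (q / 2) * Num.sqrt N%:R * S)
                          * (4 - 4 * (3 / 4) ^+ k)].
Proof.
move=> q2 H0 S0 N0 T0 TG TH TS; elim: k => [|k [I [y [Ty ycov yavg]]]].
  exists unit, (fun=> 0); split=> // [v Tv|Y YZ].
    by exists tt => j; rewrite mxE subr0 expr0 divr1 TH.
  rewrite expr0 mulr1 subrr mulr0 -(avg_cst R m 0); apply: ler_avg => s.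
  have [_ /le_trans->//] := YZ s.
  rewrite /rad_sum big1 ?normr0 // => j _.
  by rewrite mxE normr0 powR0 ?mulr0 // gt_eqF //; lra.
have [I' [y' [Ty' cI' y'cov]]] := scaled_net R N m G T H k.+1 H0 TG TH.
exists I', y'; split=> // Y YZ.
(* [p] links each new net point to a nearby old one. The links are thus indexed by [I'] alone, and
   only its cardinality enters. *)
have [p pP] := choice (fun i => ycov _ (Ty' i)).
have [i iP] := choice YZ.
set A := q * H `^ (q / 2) * Num.sqrt N%:R * S.
have A0 : 0 <= A by rewrite !mulr_ge0 ?powR_ge0 ?sqrtr_ge0 //; lra.
pose Y1 s := `|rad_sum R m q (y' (i s)) s - rad_sum R m q (y (p (i s))) s|.
pose Y2 s := `|rad_sum R m q (y (p (i s))) s|.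
have YY : avg R m Y <= avg R m Y1 + avg R m Y2.
  rewrite -avgD; apply: ler_avg => s; apply: le_trans (iP s) _.
  by rewrite -[X in `|X|](subrK (rad_sum R m q (y (p (i s))) s)) ler_normD.
have avgY2 : avg R m Y2 <= 18 * A * (4 - 4 * (3 / 4) ^+ k).
  by apply: yavg => s; exists (p (i s)).
have avgY1 : avg R m Y1 <= 18 * A * (3 / 4) ^+ k.
  have L0 : 0 < ((k.+1 + 4) * N)%:R :> R by rewrite ltr0n muln_gt0 N0 addn_gt0.
  pose r : R := (2 ^+ k)^-1.
  have r0 : 0 <= r by rewrite invr_ge0 exprn_ge0.
  have D0 : 0 <= 2 * (q * H `^ (q / 2) * S) * r.
    by rewrite !mulr_ge0 ?powR_ge0 //; lra.
  have := avg_finite_max R m I'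
    (fun a j => `|y' a 0 j| `^ q - `|y (p a) 0 j| `^ q) _ _ Y1 D0 L0.
  move=> /(_ (entropy_le_expR R N k.+1 _ N0 cI')) h.
  apply: (le_trans (h _ _)).
  - move=> a; apply: increment_sqr_le => //; try by move=> j; apply: TH.
    + exact: TS.
    + exact: TS.
  - move=> s; exists (i s); rewrite /Y1 /rad_sum -sumrB.
    by under [in leRHS]eq_bigr do rewrite mulrBr.
  rewrite natrM sqrtrM ?ler0n //.
  set l := Num.sqrt (k.+1 + 4)%:R.
  have -> : 3 * (2 * (q * H `^ (q / 2) * S) * r) * (l * Num.sqrt N%:R)
     = 6 * A * (r * l) by rewrite /A; ring.
  have rl : r * l <= 3 * (3 / 4) ^+ k.
    have := ler_wpM2l r0 (sqrt_level_le R k) => /le_trans; apply.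
    rewrite le_eqVlt; apply/orP; left; apply/eqP.
    have -> : (3 / 4) ^+ k = r * (3 / 2) ^+ k.
      by rewrite /r -exprVn -exprMn; congr (_ ^+ _); field.
    ring.
  have := ler_wpM2l (mulr_ge0 (ler0n R 6) A0) rl => /le_trans; apply.
  by rewrite le_eqVlt; apply/orP; left; apply/eqP; ring.
apply: (le_trans YY); apply: (le_trans (lerD avgY1 avgY2)).
by rewrite [in leRHS]exprS le_eqVlt; apply/orP; left; apply/eqP; field.
Qed.

(** A crude bound with a factor m, used only for the remainder beyond the last level. *)
Lemma rad_sum_dist_le (R : realType) (m : nat) (q H e : R) (v w : 'rV[R]_m)
    (s : {ffun 'I_m -> bool}) : 1 < q -> 0 <= H ->
  (forall j, `|v 0 j| <= H) -> (forall j, `|w 0 j| <= H) ->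
  (forall j, `|v 0 j - w 0 j| <= e) ->
  `|rad_sum R m q v s - rad_sum R m q w s| <= m%:R * (q * H `^ (q - 1) * e).
Proof.
move=> q1 H0 vH wH vw; rewrite /rad_sum -sumrB.
apply: le_trans (ler_norm_sum _ _ _) _.
apply: (@le_trans _ _ (\sum_(j < m) (q * H `^ (q - 1) * e))); last first.
  by rewrite sumr_const card_ord -[leLHS]mulr_natl.
apply: ler_sum => j _; rewrite -mulrBr normrM.
have -> : `|sgnb R (s j)| = 1 by rewrite /sgnb; case: (s j); rewrite ?normrN normr1.
rewrite mul1r; apply: le_trans (powR_dist_le R q _ _ q1 _ _) _ => //.
apply: ler_pM => //.
- by rewrite mulr_ge0 ?powR_ge0 //; lra.
- apply: ler_wpM2l; first by lra.
  apply: ge0_ler_powR; rewrite ?nnegrE ?le_max ?ge_max ?normr_ge0 ?vH ?wH //.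
  lra.
- exact: le_trans (ler_dist_dist _ _) (vw j).
Qed.

(** The full geometric series gives 72 = 18 * 4. For fixed m the remainder K / 2^k tends to 0, so it
    disappears from the bound. *)
Lemma chaining_bound (R : realType) (N m : nat) (G : 'M[R]_(N, m))
    (T : set 'rV[R]_m) (q H S : R) (Y : {ffun 'I_m -> bool} -> R) :
  2 <= q -> 0 < H -> 0 <= S -> (0 < N)%N -> T 0 ->
  (forall v, T v -> (v <= G)%MS) -> (forall v j, T v -> `|v 0 j| <= H) ->
  (forall v, T v -> \sum_j `|v 0 j| `^ q <= S ^+ 2) ->
  (forall s, exists2 v, T v & Y s <= `|rad_sum R m q v s|) ->
  avg R m Y <= 72 * (q * H `^ (q / 2) * Num.sqrt N%:R * S).
Proof.
move=> q2 H0 S0 N0 T0 TG TH TS YT.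
set A := q * H `^ (q / 2) * Num.sqrt N%:R * S.
have A0 : 0 <= A by rewrite !mulr_ge0 ?powR_ge0 ?sqrtr_ge0 //; lra.
have q1 : 1 < q by lra.
set K := m%:R * (q * H `^ (q - 1) * H).
have K0 : 0 <= K by rewrite !mulr_ge0 ?powR_ge0 ?ler0n ?ltW //; lra.
have level k : avg R m Y <= 72 * A + K / 2 ^+ k.
  have [I [y [Ty ycov yavg]]] :=
    chaining_level R N m G T q H S k q2 H0 S0 N0 T0 TG TH TS.
  (* Subtracting the remainder makes the variable dominated by the net, as [yavg] requires. *)
  have : avg R m (fun s => Y s - K / 2 ^+ k) <= 72 * A.
    apply: le_trans (yavg _ _) _; last first.
      have : 0 <= A * (3 / 4) ^+ k by rewrite mulr_ge0 // exprn_ge0.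
      rewrite -/A; lra.
    move=> s; have [v Tv Yv] := YT s; have [i vi] := ycov v Tv; exists i.
    rewrite lerBlDr; apply: le_trans Yv _.
    rewrite -[X in `|X|](subrK (rad_sum R m q (y i) s)).
    apply: le_trans (ler_normD _ _) _; rewrite addrC lerD2l.
    apply: le_trans (rad_sum_dist_le R m q H (H / 2 ^+ k) _ _ _ q1 (ltW H0) _ _ vi) _.
    - by move=> j; apply: TH.
    - by move=> j; apply: TH.
    - by rewrite /K !mulrA.
  by rewrite avgD avg_cst lerBlDr.
apply/ler_addgt0Pr => e e0; set k := Num.bound (K / e).
apply: le_trans (level k) _; rewrite lerD2l ler_pdivrMr ?exprn_gt0 //.
have /ltW := @upper_nthrootP R (K / e) k (leqnn _).
by rewrite ler_pdivrMr // mulrC.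
Qed.

(** * From functions to vectors of values *)

Lemma Lq_norm0 (R : realType) (d : nat) (mu : probability (BorelRd R d) R)
  (Omega : set 'rV[R]_d) (q : R) : 0 < q -> Lq_norm mu Omega q (fun=> 0) = 0.
Proof.
move=> q0; rewrite /Lq_norm; under eq_integral do rewrite normr0 powR0 ?gt_eqF //.
by rewrite integral0 powR0 // invr_eq0 gt_eqF.
Qed.

Theorem theorem4p3 (R : realType) :
  exists c : R, 0 < c /\
  forall (d : nat) (Omega : set 'rV[R]_d) (mu : probability (BorelRd R d) R)
    (N : nat) (phi : 'I_N -> 'rV[R]_d -> R) (q H : R) (m : nat)
    (x : 'I_m -> 'rV[R]_d),
    compact Omega ->
    mu (Omega : set (BorelRd R d)) = 1%E ->
    (forall i, {within Omega, continuous phi i}) ->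
    lin_indep_on Omega phi ->
    2 <= q ->
    0 < H ->
    (forall f, span_fun phi f ->
       forall y, Omega y -> `|f y| <= H * Lq_norm mu Omega q f) ->
    (forall j, Omega (x j)) ->
    bernoulli_expect (fun chi : 'I_m -> R =>
      sup [set `| \sum_(j < m) chi j * powR `|f (x j)| q |
             | f in unit_ball_q mu Omega q phi])
    <= c * q * powR H (q / 2) * Num.sqrt (N%:R)
       * sup [set Num.sqrt (\sum_(j < m) powR `|h (x j)| q)
             | h in unit_ball_q mu Omega q phi].
Proof.
exists 72; split=> // d Omega mu N phi q H m x _ _ _ _ q2 H0 nikolskii xO.
have q0 : 0 < q by lra.
set U := unit_ball_q mu Omega q phi.
have U0 : U (fun=> 0).
  split; last by rewrite Lq_norm0.
  by exists (fun=> 0); apply/funext => y; rewrite /lincomb big1 // => i _; rewrite mul0r.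
have UH f j : U f -> `|f (x j)| <= H.
  move=> [fs f1]; apply: le_trans (nikolskii f fs (x j) (xO j)) _.
  by rewrite ger_pMr.
have UHq f j : U f -> `|f (x j)| `^ q <= H `^ q.
  by move=> Uf; apply: ge0_ler_powR; rewrite ?nnegrE ?UH // ltW.
set V := [set Num.sqrt _ | h in U].
(* [sup] is a genuine least upper bound only for nonempty bounded sets; the Nikolskii bound H
   provides boundedness here and in [E_sup]. *)
have V_sup : has_sup V.
  split; first by exists (Num.sqrt (\sum_(j < m) `|(0 : R)| `^ q)), (fun=> 0).
  exists (Num.sqrt (\sum_(j < m) H `^ q)) => _ [h Uh <-].
  by rewrite ler_wsqrtr // ler_sum // => j _; apply: UHq.
have V_le h : U h -> Num.sqrt (\sum_j `|h (x j)| `^ q) <= sup V.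
  by move=> Uh; apply: ub_le_sup; [exact: V_sup.2 | exists h].
have S0 : 0 <= sup V by apply: le_trans (V_le _ U0); rewrite sqrtr_ge0.
(* The rows hold the values of the basis functions at the points, so every value vector lies in the
   row space of [G]. *)
pose G : 'M[R]_(N, m) := \matrix_(i, j) phi i (x j).
pose T : set 'rV[R]_m := [set \row_j f (x j) | f in U].
pose E (s : {ffun 'I_m -> bool}) := [set `|rad_sum R m q v s| | v in T].
pose Y (s : {ffun 'I_m -> bool}) :=
  sup [set `| \sum_(j < m) sgnb R (s j) * powR `|f (x j)| q | | f in U].
rewrite -[leLHS]/(avg R m Y).
have YE s : Y s = sup (E s).
  congr sup; apply/seteqP; split => [_ [f Uf <-]|_ [_ [f Uf <-] <-]].
    exists (\row_j f (x j)); first by exists f.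
    by rewrite /rad_sum; congr `|_|; apply: eq_bigr => j _; rewrite mxE.
  exists f => //.
  by rewrite /rad_sum; congr `|_|; apply: eq_bigr => j _; rewrite mxE.
have T0 : T 0 by exists (fun=> 0) => //; apply/rowP => j; rewrite !mxE.
have TG v : T v -> (v <= G)%MS.
  move=> [f [[a ->] _] <-]; apply/submxP; exists (\row_i a i).
  by apply/rowP => j; rewrite !mxE; apply: eq_bigr => i _; rewrite !mxE.
have TH v j : T v -> `|v 0 j| <= H by move=> [f Uf <-]; rewrite mxE UH.
have TS v : T v -> \sum_j `|v 0 j| `^ q <= sup V ^+ 2.
  move=> [f Uf <-]; under eq_bigr do rewrite mxE.
  have s0 : 0 <= \sum_(j < m) `|f (x j)| `^ q.
    by apply: sumr_ge0 => j _; rewrite powR_ge0.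
  by rewrite -(sqr_sqrtr s0) lerXn2r ?nnegrE ?sqrtr_ge0 // V_le.
have E_sup s : has_sup (E s).
  split; first by exists `|rad_sum R m q 0 s|, 0.
  exists (\sum_(j < m) H `^ q) => _ [v Tv <-].
  apply: le_trans (ler_norm_sum _ _ _) _; apply: ler_sum => j _.
  rewrite normrM /sgnb; have -> : `|if s j then 1 else -1| = 1 :> R.
    by case: (s j); rewrite ?normrN normr1.
  rewrite mul1r ger0_norm ?powR_ge0 //.
  by apply: ge0_ler_powR; rewrite ?nnegrE ?TH // ltW.
have [N0|N0] := posnP N; last first.
  (* No maximizer is known to exist: a vector within e of the supremum is chosen for each sign
     pattern, and the chaining is applied to Y - e. *)
  apply/ler_addgt0Pr => e e0; rewrite -lerBlDr -(avg_cst R m (- e)) -avgD.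
  have -> : 72 * q * H `^ (q / 2) * Num.sqrt N%:R * sup V
    = 72 * (q * H `^ (q / 2) * Num.sqrt N%:R * sup V) by rewrite !mulrA.
  apply: (chaining_bound R N m G T q H (sup V)) => // s.
  have [_ [v Tv <-] hv] := sup_adherent e0 (E_sup s).
  by exists v => //; rewrite YE ltW.
(* For N = 0 the space is trivial and both sides vanish. *)
have T_eq0 v : T v -> v = 0.
  by move=> /TG /submxP[D ->]; apply/rowP => j; rewrite !mxE big1 // => -[i iN]; subst.
rewrite N0 sqrtr0 mulr0 mul0r -(avg_cst R m 0); apply: ler_avg => s.
rewrite YE; apply: ge_sup; first exact: (E_sup s).1.
move=> _ [v /T_eq0 -> <-]; rewrite /rad_sum big1 ?normr0 // => j _.
by rewrite mxE normr0 powR0 ?mulr0 // gt_eqF.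
Qed.
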